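(* (1) $V(2+\sqrt2)_{2,1}(\mathbb{Z}[\sqrt2])=\emptyset$. (2) There are no $\mathbb{Z}[\sqrt2]$-PCFs of $\sqrt{2+\sqrt2}$ of type $(2,1)$.
   Context: Put $D(c)=\begin{bmatrix}c&1\\1&0\end{bmatrix}$ and $\begin{bmatrix}E_{11}&E_{12}\\ E_{21}&E_{22}\end{bmatrix}=D(y_1)D(y_2)\,D(x_1)\,\bigl(D(y_1)D(y_2)\bigr)^{-1}$, with entries in $\mathbb{Z}[y_1,y_2,x_1]$. The PCF variety $V(2+\sqrt2)_{2,1}\subseteq\mathbb{A}^2\times\mathbb{A}^1$ (coordinates $(y_1,y_2,x_1)$), associated with the polynomial $x^2-(2+\sqrt2)$, is defined by $A(E_{22}-E_{11})=BE_{21}$, $-AE_{12}=CE_{21}$, $-BE_{12}=C(E_{22}-E_{11})$ for $(A,B,C)=(1,0,-(2+\sqrt2))$; explicitly, by $$2y_1y_2^2-2y_1y_2x_1-2y_1+2y_2-x_1=0,$$ $$-y_1^2y_2^2+y_1^2y_2x_1+y_1^2-2y_1y_2+y_1x_1-1=-(2+\sqrt2)(y_2x_1-y_2^2+1).$$ A $\mathbb{Z}[\sqrt2]$-PCF of type $(2,1)$ of a number $\beta$ is a periodic continued fraction $[b_1,b_2,\overline{a_1}]$, with $(b_1,b_2,a_1)\in\mathbb{Z}[\sqrt2]^3$, whose value is $\beta$. Here the partial quotients $c_1,c_2,\ldots$ are $b_1,b_2,a_1,a_1,\ldots$; the $n$-th convergent is $M_{11}/M_{21}\in\mathbb{P}^1(\mathbb{C})$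 with $M=D(c_1)\cdots D(c_n)$, and the value is the limit of the convergents in $\mathbb{P}^1(\mathbb{C})$, if it exists. *)

(* Defs.v *)
From HB Require Import structures.
From mathcomp Require Import all_boot all_order all_algebra.
From mathcomp Require Import complex.
From mathcomp Require Import all_classical all_reals all_analysis.
Set Implicit Arguments.
Unset Strict Implicit.
Unset Printing Implicit Defensive.
Import Order.TTheory GRing.Theory Num.Theory.
Import numFieldNormedType.Exports.

Local Open Scope classical_set_scope.
Local Open Scope complex_scope.
Local Open Scope ring_scope.

(* Matrix rows and columns are numbered from 0 in the library, so the entry
   written E_{11} in the mathematics is E 0 0, E_{21} is E 1 0, and so on. *)

Definition D (K : comUnitRingType) (c : K) : 'M[K]_2 :=
  \matrix_(i < 2, j < 2) nth 0 (nth [::] [:: [:: c; 1]; [:: 1; 0]] i) j.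

(* \det (D c) = -1, so the inverse exists over every commutative ring K, and
   PCF_E y1 y2 x1 is the evaluation at (y1, y2, x1) of the matrix with entries
   in Z[y1, y2, x1]. *)
Definition PCF_E (K : comUnitRingType) (y1 y2 x1 : K) : 'M[K]_2 :=
  (D y1 *m D y2) *m D x1 *m invmx (D y1 *m D y2).

(* The K-points of the PCF variety V(A x^2 + B x + C)_{2,1} in A^2 x A^1. *)
Definition PCF_variety21 (K : comUnitRingType) (A B C : K) : set (K * K * K) :=
  [set p | let: (y1, y2, x1) := p in
           let E := PCF_E y1 y2 x1 in
           [/\ A * (E 1 1 - E 0 0) = B * E 1 0,
               - (A * E 0 1) = C * E 1 0
             & - (B * E 0 1) = C * (E 1 1 - E 0 0)]].

Section ComplexNumbers.
Variable R : realType.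

Definition sqrt2 : R[i] := (Num.sqrt 2)%:C.

Definition sqrt_2_plus_sqrt2 : R[i] := (Num.sqrt (2 + Num.sqrt 2))%:C.

Definition Zsqrt2 : set R[i] :=
  [set z | exists a b : int, z = a%:~R + b%:~R * sqrt2].

Definition V_2_plus_sqrt2 : set (R[i] * R[i] * R[i]) :=
  PCF_variety21 1 0 (- (2 + sqrt2)).

Definition V_2_plus_sqrt2_Zsqrt2 : set (R[i] * R[i] * R[i]) :=
  V_2_plus_sqrt2 `&` (Zsqrt2 `*` Zsqrt2 `*` Zsqrt2).

(* The Riemann sphere: Some z stands for [z : 1] and None for [1 : 0].  The
   alias R[i]^o carries the usual topology of the complex plane. *)
Definition P1C := one_point_compactification R[i]^o.

Definition P1C_of_C (z : R[i]) : P1C := Some z.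

(* The point [x : y], meaningful when (x, y) <> (0, 0). *)
Definition P1C_point (x y : R[i]) : P1C :=
  if y == 0 then None else P1C_of_C (x / y).

(* The partial quotients c_1, c_2, ... of [b_1, ..., b_N, \overline{a_1, ...,
   a_k}] with the index shifted by one: partial_quotient b a n is c_{n+1}. *)
Definition partial_quotient (b a : seq R[i]) (n : nat) : R[i] :=
  if (n < size b)%N then b`_n else a`_((n - size b) %% size a).

Definition convergent (b a : seq R[i]) (n : nat) : P1C :=
  let M : 'M[R[i]]_2 := \prod_(0 <= j < n) D (partial_quotient b a j) in
  P1C_point (M 0 0) (M 1 0).

Definition has_PCF_value (b a : seq R[i]) (beta : P1C) : Prop :=
  convergent b a n @[n --> \oo] --> beta.

(* [b_1, b_2, \overline{a_1}] is a Z[sqrt 2]-PCF of type (2,1) of beta *)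
Definition is_Zsqrt2_PCF21_of (beta b1 b2 a1 : R[i]) : Prop :=
  [/\ Zsqrt2 b1, Zsqrt2 b2, Zsqrt2 a1
    & has_PCF_value [:: b1; b2] [:: a1] (P1C_of_C beta)].

End ComplexNumbers.

Arguments V_2_plus_sqrt2_Zsqrt2 : clear implicits.

(* Main.v *)
(* (1) On V(2 + sqrt 2)_{2,1} one has E_11 = E_22 = t and E_12 = (2 + sqrt 2) s
   with s = E_21; since E has determinant -1 and trace x1 = 2 t, this gives
   t^2 + 1 = (2 + sqrt 2) s^2 and (y2 - t)^2 = t^2 + 1 - s.  Over Z[sqrt 2] the
   two equations are incompatible at the prime sqrt 2.
   (2) From the second one on, each convergent is the image of its predecessor
   under E, so a finite limit beta satisfies
   E_21 beta^2 + (E_22 - E_11) beta - E_12 = 0.  As beta = sqrt (2 + sqrt 2) has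
   degree 2 over Q(sqrt 2), this forces (b1, b2, a1) onto the variety. *)

Require Import Defs.
From mathcomp Require Import all_boot all_order all_algebra.
From mathcomp Require Import complex.
From mathcomp Require Import all_classical all_reals all_analysis.
From mathcomp Require Import ring zify.
Set Implicit Arguments.
Unset Strict Implicit.
Unset Printing Implicit Defensive.
Import Order.TTheory GRing.Theory Num.Theory numFieldNormedType.Exports.

Local Open Scope classical_set_scope.
Local Open Scope complex_scope.
Local Open Scope ring_scope.

(** * Parity arguments over the integers *)

(** For nonzero [b] the exponent of 2 would be even on the left and odd on the right. *)
Lemma int_sqrt2_irrational (a b : int) : a ^+ 2 = 2 * b ^+ 2 -> b = 0.
Proof.
have [-> //|b0 /(congr1 absz)] := eqVneq b 0.
rewrite !expr2 !abszM => h.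
have b1 : (0 < `|b|)%N by rewrite absz_gt0.
have a1 : (0 < `|a|)%N.
  by rewrite -[X in is_true X]andbb -muln_gt0 h !muln_gt0 b1.
move: (congr1 (logn 2) h); rewrite !lognM ?muln_gt0 ?b1 ?a1 //=.
rewrite (_ : logn 2 (1 + 1) = 1%N) //; lia.
Qed.

(** With t = a + b sqrt 2, s = p + q sqrt 2, z = m + n sqrt 2, these are both coordinates of t^2 + 1
    = (2 + sqrt 2) s^2 and the sqrt 2-coordinate of z^2 = t^2 + 1 - s. The second equation makes [p]
    even, the third then makes [q] even, and the first makes [a] odd. Modulo 4 the second now makes
    [b] even, so the first reads 2 = 0 modulo 4. *)
Lemma parity_obstruction (a b p q m n : int) :
  a ^+ 2 + 2 * b ^+ 2 + 1 = 2 * p ^+ 2 + 4 * q ^+ 2 + 4 * p * q ->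
  2 * a * b = p ^+ 2 + 2 * q ^+ 2 + 4 * p * q ->
  2 * m * n = p ^+ 2 + 2 * q ^+ 2 + 4 * p * q - q -> False.
Proof.
have par (x : int) : exists k, x = 2 * k \/ x = 2 * k + 1.
  by exists (x %/ 2)%Z; lia.
have [a' [->|->]] := par a; have [b' [->|->]] := par b;
have [p' [->|->]] := par p; have [q' [->|->]] := par q; rewrite ?expr2; lia.
Qed.

(** * Arithmetic of Z[sqrt 2] *)

Section Zsqrt2Ring.
Variable R : realType.
Local Notation r := (sqrt2 R).
Local Notation Zr := (Zsqrt2 (R := R)).

Lemma sqrt2_sqr : r ^+ 2 = 2.
Proof. by rewrite /sqrt2 -rmorphXn /= sqr_sqrtr ?ler0n // rmorph_nat. Qed.

Lemma sqrt_2_plus_sqrt2_sqr : sqrt_2_plus_sqrt2 R ^+ 2 = 2 + r.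
Proof.
rewrite /sqrt_2_plus_sqrt2 -rmorphXn /= sqr_sqrtr; last first.
  by rewrite addr_ge0 ?ler0n ?sqrtr_ge0.
by rewrite rmorphD rmorph_nat.
Qed.

Lemma Zsqrt2_eq0 (a b : int) : a%:~R + b%:~R * r = 0 -> a = 0 /\ b = 0.
Proof.
move=> h; have ab : a ^+ 2 = 2 * b ^+ 2.
  apply: (intr_inj (R := R[i])); rewrite !expr2 !intrM.
  have -> : a%:~R = - (b%:~R * r) by apply/eqP; rewrite -addr_eq0 h.
  by rewrite -[2%:~R]/(2%R : R[i]) -sqrt2_sqr; ring.
have b0 := int_sqrt2_irrational ab.
by move: ab; rewrite b0 => /eqP; rewrite expr0n mulr0 sqrf_eq0 => /eqP.
Qed.

Lemma Zsqrt2_inj (a b c d : int) :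
  a%:~R + b%:~R * r = c%:~R + d%:~R * r -> a = c /\ b = d.
Proof.
move=> h; have [] : a - c = 0 /\ b - d = 0.
  by apply: Zsqrt2_eq0; rewrite !rmorphB /= mulrBl addrACA h -opprD subrr.
by move=> /subr0_eq -> /subr0_eq ->.
Qed.

Lemma Zsqrt2_1 : Zr 1.
Proof. by exists 1, 0; rewrite mul0r addr0. Qed.

Lemma Zsqrt2_sqrt2 : Zr r.
Proof. by exists 0, 1; rewrite mul1r add0r. Qed.

Lemma Zsqrt2B x y : Zr x -> Zr y -> Zr (x - y).
Proof.
move=> [a [b ->]] [c [d ->]]; exists (a - c), (b - d).
by rewrite !rmorphB /=; ring.
Qed.

Lemma Zsqrt2D x y : Zr x -> Zr y -> Zr (x + y).
Proof.
move=> [a [b ->]] [c [d ->]]; exists (a + c), (b + d).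
by rewrite !rmorphD /=; ring.
Qed.

Lemma Zsqrt2_mulE (a b c d : int) :
  (a%:~R + b%:~R * r) * (c%:~R + d%:~R * r) =
  (a * c + 2 * b * d)%:~R + (a * d + b * c)%:~R * r.
Proof.
rewrite !rmorphD !rmorphM /= -[2%:~R]/(2%R : R[i]) -sqrt2_sqr; ring.
Qed.

Lemma Zsqrt2M x y : Zr x -> Zr y -> Zr (x * y).
Proof.
by move=> [a [b ->]] [c [d ->]]; rewrite Zsqrt2_mulE; do 2 eexists.
Qed.

(* Taking norms to Q gives N(w)^2 = 2 N(e)^2. *)
Lemma two_plus_sqrt2_nonsquare e w :
  Zr e -> Zr w -> w ^+ 2 = (2 + r) * e ^+ 2 -> e = 0.
Proof.
move=> [a [b ->]] [c [d ->]].
have -> : 2 + r = (2 : int)%:~R + (1 : int)%:~R * r by rewrite mul1r.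
rewrite !expr2 !Zsqrt2_mulE => /Zsqrt2_inj[h1 h2].
have /int_sqrt2_irrational/eqP :
    (c ^+ 2 - 2 * d ^+ 2) ^+ 2 = 2 * (a ^+ 2 - 2 * b ^+ 2) ^+ 2.
  (* The middle term is the norm of [w ^+ 2] in coordinates; the factor 2 is the norm of [2 + r]. *)
  transitivity ((c * c + 2 * d * d) ^+ 2 - 2 * (c * d + d * c) ^+ 2); first ring.
  by rewrite h1 h2; ring.
rewrite subr_eq0 => /eqP /[dup] ab /int_sqrt2_irrational b0.
by move: ab; rewrite b0 mul0r addr0 expr0n mulr0 => /eqP; rewrite sqrf_eq0 => /eqP ->.
Qed.

(* The first equation forces s to have valuation exactly 1 at the prime sqrt 2;
   the second one makes that valuation even. *)
Lemma no_Zsqrt2_solution t s z : Zr t -> Zr s -> Zr z ->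
  t ^+ 2 + 1 = (2 + r) * s ^+ 2 -> z ^+ 2 = t ^+ 2 + 1 - s -> False.
Proof.
move=> [a [b ->]] [p [q ->]] [m [n ->]] h1; rewrite h1; move: h1.
have -> : 2 + r = (2 : int)%:~R + (1 : int)%:~R * r by rewrite mul1r.
rewrite !expr2 !Zsqrt2_mulE => h1 h2.
have /Zsqrt2_inj[e1 e2] :
    (a * a + 2 * b * b + 1)%:~R + (a * b + b * a)%:~R * r
    = (2 * (p * p + 2 * q * q) + 2 * 1 * (p * q + q * p))%:~R +
      (2 * (p * q + q * p) + 1 * (p * p + 2 * q * q))%:~R * r.
  by rewrite -h1 [in LHS]rmorphD /=; ring.
have /Zsqrt2_inj[_ e3] :
    (m * m + 2 * n * n)%:~R + (m * n + n * m)%:~R * r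
    = (2 * (p * p + 2 * q * q) + 2 * 1 * (p * q + q * p) - p)%:~R +
      (2 * (p * q + q * p) + 1 * (p * p + 2 * q * q) - q)%:~R * r.
  by rewrite h2 [in RHS]rmorphB [in RHS](rmorphB _ _ q) /=; ring.
by apply: (@parity_obstruction a b p q m n); rewrite ?expr2; lia.
Qed.

End Zsqrt2Ring.

(** * Entries of the matrix E *)

Lemma DE (K : comUnitRingType) (c : K) :
  [/\ D c 0 0 = c, D c 0 1 = 1, D c 1 0 = 1 & D c 1 1 = 0].
Proof. by rewrite !mxE. Qed.

Lemma mul2mxE (K : pzRingType) (A B : 'M[K]_2) i j :
  (A *m B) i j = A i 0 * B 0 j + A i 1 * B 1 j.
Proof.
rewrite mxE !big_ord_recl big_ord0 addr0.
by rewrite (_ : lift ord0 ord0 = 1) //; exact: val_inj.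
Qed.

Lemma det_D (K : comUnitRingType) (c : K) : \det (D c) = -1.
Proof.
rewrite (expand_det_row _ 1) !big_ord_recl big_ord0 /cofactor !det_mx11 !mxE /=.
by rewrite !(mul0r, mul1r, addr0, expr1, expr0, mulr1).
Qed.

Lemma D_mul_unit (K : comUnitRingType) (y1 y2 : K) :
  D y1 *m D y2 \in unitmx.
Proof. by rewrite unitmxE det_mulmx !det_D mulrNN mulr1 unitr1. Qed.

Lemma PCF_E_mul (K : comUnitRingType) (y1 y2 x1 : K) :
  PCF_E y1 y2 x1 *m (D y1 *m D y2) = D y1 *m D y2 *m D x1.
Proof. by rewrite /PCF_E mulmxKV ?D_mul_unit. Qed.

Lemma PCF_E_entries (K : comUnitRingType) (y1 y2 x1 : K) :
  let E := PCF_E y1 y2 x1 in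
  [/\ E 0 0 = (y1 * y2 + 1) * x1 + y1 - y2 * (y1 * y2 + 1),
      E 0 1 = (y1 * y2 + 1) ^+ 2 - y1 * ((y1 * y2 + 1) * x1 + y1),
      E 1 0 = y2 * x1 + 1 - y2 ^+ 2
    & E 1 1 = y2 * (y1 * y2 + 1) - y1 * (y2 * x1 + 1)].
Proof.
have /matrixP EP := PCF_E_mul y1 y2 x1.
move: (PCF_E _ _ _) EP => E EP /=.
move: (EP 0 0) (EP 0 1) (EP 1 0) (EP 1 1).
rewrite !mul2mxE; have [-> -> -> ->] := DE y1; have [-> -> -> ->] := DE y2.
have [-> -> -> ->] := DE x1; rewrite !(mulr1, mul1r, mulr0, mul0r, addr0, add0r).
(* Each row of E solves a linear system with matrix [D y1 *m D y2], of determinant 1, so Cramer's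
   rule needs no division. *)
have cramer (a b : K) u v : a * (y1 * y2 + 1) + b * y2 = u ->
    a * y1 + b = v -> a = u - y2 * v /\ b = (y1 * y2 + 1) * v - y1 * u.
  by move=> <- <-; split; ring.
move=> h1 h2 h3 h4.
have [-> ->] := cramer _ _ _ _ h1 h2; have [-> ->] := cramer _ _ _ _ h3 h4.
by split; ring.
Qed.

(** * Points of the variety and limits of convergents *)

Section PCF.
Variable R : realType.
Local Notation r := (sqrt2 R).
Local Notation Zr := (Zsqrt2 (R := R)).
Local Notation V := (V_2_plus_sqrt2 (R := R)).

Lemma PCF_E_Zsqrt2 y1 y2 x1 : Zr y1 -> Zr y2 -> Zr x1 ->
  forall i j, Zr (PCF_E y1 y2 x1 i j).
Proof.
move=> Z1 Z2 Zx; have [e00 e01 e10 e11] := PCF_E_entries y1 y2 x1.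
have ZE : [/\ Zr (PCF_E y1 y2 x1 0 0), Zr (PCF_E y1 y2 x1 0 1),
              Zr (PCF_E y1 y2 x1 1 0) & Zr (PCF_E y1 y2 x1 1 1)].
  rewrite e00 e01 e10 e11 !expr2; split;
  by repeat first [exact: Zsqrt2_1 | assumption | apply: Zsqrt2B
                  | apply: Zsqrt2M | apply: Zsqrt2D].
case: ZE => z00 z01 z10 z11 i j.
have o2 (k : 'I_2) : k = 0 \/ k = 1.
  by case: k => -[|[|//]] ?; [left|right]; exact: val_inj.
by have [->|->] := o2 i; have [->|->] := o2 j.
Qed.

Lemma V_Zsqrt2_empty y1 y2 x1 : Zr y1 -> Zr y2 -> Zr x1 -> ~ V (y1, y2, x1).
Proof.
move=> Z1 Z2 Zx [] /=; rewrite mul0r !mul1r mulNr => /subr0_eq e1 /oppr_inj e2 _.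
have ZE := PCF_E_Zsqrt2 Z1 Z2 Zx.
have [e00 e01 e10 e11] := PCF_E_entries y1 y2 x1.
have det_E : PCF_E y1 y2 x1 0 0 * PCF_E y1 y2 x1 1 1
    - PCF_E y1 y2 x1 0 1 * PCF_E y1 y2 x1 1 0 = -1.
  by rewrite e00 e01 e10 e11; ring.
have tr_E : x1 = PCF_E y1 y2 x1 0 0 + PCF_E y1 y2 x1 1 1.
  by rewrite e00 e11; ring.
apply: (no_Zsqrt2_solution (ZE 0 0) (ZE 1 0) (Zsqrt2B Z2 (ZE 0 0))).
  move: det_E; rewrite e1 e2 => /(congr1 (+%R^~ 1)); rewrite addNr => det_E.
  by apply: subr0_eq; rewrite -det_E; ring.
(* Put x1 = 2t in the formula for [E 1 0] and complete the square in [y2]. *)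
rewrite e1 in tr_E; rewrite e10.
by move: (PCF_E y1 y2 x1 0 0) tr_E => t ->; ring.
Qed.

(** Pass to the limit in u_{n+1} (E_21 u_n + E_22) = E_11 u_n + E_12, where u_n = x_n / y_n. With
    denominators cleared, E_21 l + E_22 may vanish. *)
Lemma moebius_orbit_limit_fixed (K : numFieldType) (E : 'M[K]_2)
    (x y : nat -> K) (l : K) :
  (forall n, x n.+1 = E 0 0 * x n + E 0 1 * y n) ->
  (forall n, y n.+1 = E 1 0 * x n + E 1 1 * y n) ->
  (\forall n \near \oo, y n != 0) ->
  x n / y n @[n --> \oo] --> (l : K^o) ->
  l * (E 1 0 * l + E 1 1) = E 0 0 * l + E 0 1.
Proof.
move=> hx hy y0 cu; set u := fun n => x n / y n in cu.
have cu1 : u n.+1 @[n --> \oo] --> l by rewrite (cvg_shiftS u).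
have aff (a b : K) : a * u n + b @[n --> \oo] --> a * l + b.
  by apply: cvgD; [apply: cvgM => //; exact: cvg_cst|exact: cvg_cst].
have y1 : \forall n \near \oo, y n.+1 != 0.
  by case: y0 => N _ h; exists N => // n Nn; apply: h; exact: leqW.
have lhs : u n.+1 * (E 1 0 * u n + E 1 1) @[n --> \oo] -->
    l * (E 1 0 * l + E 1 1) by exact: cvgM.
apply: (cvg_unique (@norm_hausdorff K K^o) lhs).
apply: cvg_trans (aff (E 0 0) (E 0 1)); apply: near_eq_cvg.
near=> n; have yn0 : y n != 0 by near: n.
have : y n.+1 != 0 by near: n.
rewrite /u hx hy => yn1; field; exact/andP.
Unshelve. all: by end_near.
Qed.

(** A neighbourhood of a finite point, embedded in the sphere, is still a neighbourhood and misses
    the point at infinity. *)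
Lemma P1C_cvg_finite (x y : nat -> R[i]) (l : R[i]) :
  P1C_point (x n) (y n) @[n --> \oo] --> P1C_of_C l ->
  (\forall n \near \oo, y n != 0) /\ x n / y n @[n --> \oo] --> (l : R[i]^o).
Proof.
move=> h.
have hU (U : set R[i]^o) : nbhs (l : R[i]^o) U ->
    \forall n \near \oo, y n != 0 /\ U (x n / y n).
  move=> /(@one_point_compactification_some_nbhs R[i]^o)/h[N _ hN].
  exists N => // n /hN[v Uv]; rewrite /P1C_point.
  by case: eqP => // _ [<-].
split; last by move=> U /hU; apply: filterS => n [].
by apply: filterS (hU _ filterT) => n [].
Qed.

(** With P = D(b1) D(b2), E P D(a1)^n = P D(a1)^{n+1}; the index starts at 2, the length of the
    preperiod. *)
Lemma convergent_recurrence (b1 b2 a1 : R[i]) (n : nat) :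
  let M k : 'M[R[i]]_2 :=
    \prod_(0 <= j < k) D (partial_quotient [:: b1; b2] [:: a1] j) in
  M n.+3 = PCF_E b1 b2 a1 *m M n.+2.
Proof.
move=> M; rewrite /M; elim: n => [|n IHn].
  by rewrite !big_nat_recr //= big_geq // mul1r -!mulmxE -PCF_E_mul.
rewrite big_nat_recr //= IHn -[LHS]mulmxA; congr (_ *m _).
by rewrite -IHn [RHS]big_nat_recr //= /partial_quotient /= !modn1.
Qed.

Lemma sqrt_2_plus_sqrt2_PCF_in_V b1 b2 a1 :
  is_Zsqrt2_PCF21_of (sqrt_2_plus_sqrt2 R) b1 b2 a1 -> V (b1, b2, a1).
Proof.
move=> [Z1 Z2 Za]; rewrite /has_PCF_value /convergent.
set M := fun n => \prod_(0 <= j < n) D (partial_quotient [:: b1; b2] [:: a1] j).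
move=> cM; set b := sqrt_2_plus_sqrt2 R in cM.
have ZE := PCF_E_Zsqrt2 Z1 Z2 Za; set E := PCF_E b1 b2 a1 in ZE *.
have {cM} [y0 cu] : (\forall n \near \oo, M n.+2 1 0 != 0) /\
    M n.+2 0 0 / M n.+2 1 0 @[n --> \oo] --> (b : R[i]^o).
  apply: P1C_cvg_finite.
  by move=> U /cM[N _ h]; exists N => // n Nn; apply: (h n.+2); rewrite /= !leqW.
have rec n i : M n.+3 i 0 = E i 0 * M n.+2 0 0 + E i 1 * M n.+2 1 0.
  by rewrite /M convergent_recurrence mul2mxE.
have fixed := moebius_orbit_limit_fixed (fun n => rec n 0) (fun n => rec n 1) y0 cu.
have b2E : b ^+ 2 = 2 + r := sqrt_2_plus_sqrt2_sqr R.
(* Since b^2 = 2 + sqrt 2, the fixed-point equation separates into w = e b with e and w in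
   Z[sqrt 2]; squaring gives w^2 = (2 + sqrt 2) e^2. *)
set e := E 1 1 - E 0 0; set w := E 0 1 - (2 + r) * E 1 0.
have we : w = e * b.
  have -> : w = E 0 0 * b + E 0 1 - b * (E 1 0 * b + E 1 1) + e * b.
    by rewrite /w /e -b2E; ring.
  by rewrite fixed subrr add0r.
have Z2r : Zr (2 + r).
  apply: Zsqrt2D (Zsqrt2_sqrt2 R); exact: Zsqrt2D (Zsqrt2_1 R) (Zsqrt2_1 R).
have e0 : e = 0.
  apply: (@two_plus_sqrt2_nonsquare R e w).
  - exact: Zsqrt2B.
  - by apply: Zsqrt2B => //; exact: Zsqrt2M.
  - by rewrite we exprMn b2E mulrC.
have w0 : w = 0 by rewrite we e0 mul0r.
split; rewrite -/E; first by rewrite -/e e0 mulr0 mul0r.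
  by rewrite mul1r mulNr; congr (- _); exact: subr0_eq.
by rewrite -/e e0 mulr0 mul0r oppr0.
Qed.

End PCF.

Theorem proposition7p4 (R : realType) :
  V_2_plus_sqrt2_Zsqrt2 R = set0 /\
  ~ (exists b1 b2 a1 : R[i],
       is_Zsqrt2_PCF21_of (sqrt_2_plus_sqrt2 R) b1 b2 a1).
Proof.
split.
  apply/seteqP; split=> // -[[y1 y2] x1] [Vp [[Z1 Z2] Zx]].
  exact: (V_Zsqrt2_empty Z1 Z2 Zx).
move=> [b1 [b2 [a1 /[dup] [[Z1 Z2 Za _]]]]] /sqrt_2_plus_sqrt2_PCF_in_V.
exact: (V_Zsqrt2_empty Z1 Z2 Za).
Qed.
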